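(* Let $k\ge 1$. For odd primes $p_1<\cdots<p_k$, let $C(p_1,\ldots,p_k)$ denote the condition: with $n=p_1\cdots p_k$, the derivative $\Phi_n'(x)$ of the $n$-th cyclotomic polynomial has exactly $2^k-1$ real roots (counted with multiplicity), and each real root of $\Phi_n'(x)$ is simple. Then $C(p_1,\ldots,p_k)$ holds whenever the primes are sufficiently separated, that is, $$\forall p_1\ \ \exists q_2>p_1\ \ \forall p_2\ge q_2\ \ \exists q_3>p_2\ \ \forall p_3\ge q_3\ \cdots\ \exists q_k>p_{k-1}\ \ \forall p_k\ge q_k:\quad C(p_1,\ldots,p_k),$$ where the $p_i$ range over odd primes and the $q_i$ over integers (so $q_i$ may depend on $p_1,\ldots,p_{i-1}$; for $k=1$ the statement is $\forall p_1\ C(p_1)$).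
   Context: $\Phi_n(x)=\prod_{1\le j\le n,\ \gcd(j,n)=1}\left(x-e^{2\pi i j/n}\right)$ is the $n$-th cyclotomic polynomial. *)

(* Defs.v *)
From HB Require Import structures.
From mathcomp Require Import all_boot all_order all_algebra.
From mathcomp Require Import all_field.
From mathcomp Require Import polyrcf.
From mathcomp Require Import reals.

Set Implicit Arguments.
Unset Strict Implicit.
Unset Printing Implicit Defensive.

Import GRing.Theory Num.Theory.
Local Open Scope ring_scope.

Definition odd_prime (p : nat) : bool := prime p && odd p.

(* The library's ['Phi_n] has integer coefficients; by [Cintr_Cyclotomic] its
   image over [algC] is the product of the ['X - (z ^+ j)%:P], j coprime to n,
   for any primitive n-th root of unity z. *)
Definition real_Phi (R : realType) (n : nat) : {poly R} := map_poly intr 'Phi_n.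

(* [rootsR p] lists the distinct real roots of a nonzero p; it is empty for
   p = 0, which cannot be confused with the count below since 0 < 2 ^ k - 1
   for k > 0. *)
Definition nb_real_roots (R : realType) (p : {poly R}) : nat :=
  (\sum_(x <- rootsR p) mup x p)%N.

Definition cyclotomic_deriv_cond (R : realType) (ps : seq nat) : Prop :=
  let f := (real_Phi R (\prod_(p <- ps) p)%N)^`() in
  nb_real_roots f = (2 ^ size ps - 1)%N /\
  (forall x : R, root f x -> mup x f = 1%N).

(* Starting from ps = [:: p_1; ...; p_i], the m further quantifier blocks
     exists q_(i+1) > p_i, forall odd primes p_(i+1) >= q_(i+1), ...
   in front of C p_1 ... p_(i+m). The thresholds are natural numbers: being
   larger than a prime, an integer threshold is nonnegative. *)
Fixpoint separated_quant (C : seq nat -> Prop) (m : nat) (ps : seq nat) : Prop :=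
  if m is m'.+1 then
    exists q : nat, (last 0%N ps < q)%N /\
      forall p : nat, odd_prime p -> (q <= p)%N ->
        separated_quant C m' (rcons ps p)
  else C ps.

(* Main.v *)
Require Import Defs.
From mathcomp Require Import all_boot all_order all_algebra.
From mathcomp Require Import all_field.
From mathcomp Require Import polyrcf.
From mathcomp Require Import boolp classical_sets reals topology normedtype.
From mathcomp Require Import derive realfun.
From mathcomp Require Import ring lra zify.

(** For a prime [p] not dividing [n], [Phi_(np) * Phi_n = Phi_n o X^p]
    ([real_Phi_mul_prime]).  The proof is an induction on the number of primes,
    in which one factor is added at a time: it uses nothing about [f = Phi_n]
    except this equation and the invariant [simple_critical f m], which says
    that [f'] has [m] real roots, all simple, and that the logarithmic
    derivative [h x = x f'(x) / f(x)] is bounded and bounded away from [0]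
    for [|x| >= 1] (so that every real root of [f'] lies in [(-1, 1)]).

    Let [g * f = f o X^p] with [p] odd and large, and write [s = x^p].  Then
        [x g'(x) / g(x) = p h(s) - h(x)],
    and at a root of [g'],
        [x^2 g''(x) / g(x) = p^2 s h'(s) - x h'(x)]
    ([xderiv_g], [xderiv2_g]).  So the nonzero roots of [g'] are the solutions
    of [p h(s) = h(x)].  Since [h >= c > 0] on [|x| >= 1], there are none with
    [|x| >= 1] once [p] is large.  Fix [rho < 1] close to [1], so that
    [h > 0] on [rho <= |x| <= 1].
    - For [|x| <= rho], [s] is tiny, so [h(x)] is close to [0] and [x] is close
      to a zero of [h], that is to [0] or to a root [z] of [f'].  Next to each
      such [z] there is exactly one root of [g'], and none is close to [0].
    - For [rho <= |x| < 1], [h(s) = h(x) / p] is small, so it is now [s] which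
      is close to a zero of [h]: each root [z] of [f'] produces exactly one
      root [x] of [g'] with [x^p] close to [z].  The zero at the origin
      also produces exactly one, on the side where [h(s) > 0], because
      [h(x)] is positive there.
    Hence [g'] has [m + (m + 1) = 2 m + 1] real roots, and from
    [m = 2^k - 1] one gets [2^(k+1) - 1].

    Exactly one root per region is obtained from the intermediate value theorem
    and from the sign of [g''] at the roots of [g']: all roots in a
    region are crossings in the same direction, so there are no two of them
    ([unique_crossing]); this sign also shows that the roots are simple.
    The invariant passes from [f] to [g] in [simple_critical_large_prime]; it is
    started by [f = 1 + X + ... + X^(p-1)] in [simple_critical_geometric]. *)

Set Implicit Arguments.
Unset Strict Implicit.
Unset Printing Implicit Defensive.

Import Order.TTheory GRing.Theory Num.Theory numFieldNormedType.Exports.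
Local Open Scope classical_set_scope.
Local Open Scope ring_scope.

(** * Cyclotomic polynomials and a new prime factor *)

Lemma perm_divisors_mulp (n p : nat) : (0 < n)%N -> prime p -> ~~ (p %| n)%N ->
  perm_eq (divisors (n * p)) (divisors n ++ [seq (d * p)%N | d <- divisors n]).
Proof.
move=> n0 pp pn; have p0 := prime_gt0 pp.
apply: uniq_perm; first exact: divisors_uniq.
  rewrite cat_uniq divisors_uniq map_inj_uniq ?divisors_uniq //=; last first.
    by move=> a b /eqP; rewrite eqn_pmul2r // => /eqP.
  rewrite andbT; apply/hasPn => _ /mapP[d _ ->].
  rewrite -dvdn_divisors //; apply: contra pn => /(dvdn_trans _); apply.
  exact: dvdn_mull.
move=> d; rewrite mem_cat -!dvdn_divisors ?muln_gt0 ?n0 //.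
apply/idP/orP => [dnp | [dn | /mapP[e]]].
- have [pd | pd] := boolP (p %| d)%N.
    right; apply/mapP; exists (d %/ p)%N; last by rewrite divnK.
    by rewrite -dvdn_divisors // -(dvdn_pmul2r p0) divnK.
  left; move: dnp; rewrite Gauss_dvdl // coprime_sym.
  by rewrite prime_coprime.
- exact: dvdn_mulr.
- by rewrite -dvdn_divisors // => en ->; rewrite dvdn_pmul2r.
Qed.

(** Taking the product of the claimed identities over all divisors of [n] gives
    [X^(np) - 1] on both sides; strong induction cancels the factors of the
    proper divisors. *)
Lemma Cyclotomic_mul_prime (n p : nat) :
    (0 < n)%N -> prime p -> ~~ (p %| n)%N ->
  'Phi_(n * p) * 'Phi_n = 'Phi_n \Po 'X^p.
Proof.
elim/ltn_ind: n => n IH n0 pp pn; have p0 := prime_gt0 pp.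
have nn : n \in divisors n by rewrite -dvdn_divisors.
have prodP : \prod_(d <- divisors n) ('Phi_(d * p) * 'Phi_d)
    = \prod_(d <- divisors n) ('Phi_d \Po 'X^p).
  have -> : \prod_(d <- divisors n) ('Phi_d \Po 'X^p)
      = (\prod_(d <- divisors n) 'Phi_d) \Po 'X^p.
    by rewrite rmorph_prod.
  rewrite prod_Cyclotomic // comp_polyB rmorphXn /= comp_polyX comp_polyC
    -exprM mulnC.
  rewrite -prod_Cyclotomic ?muln_gt0 ?n0 //.
  rewrite (perm_big _ (perm_divisors_mulp n0 pp pn)) big_cat big_map big_split.
  by rewrite /= mulrC.
move: prodP; rewrite !(bigD1_seq n) ?divisors_uniq //=.
set Q := \prod_(d <- _ | _) _; set Q' := \prod_(d <- _ | _) _.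
have -> : Q' = Q.
  rewrite /Q /Q' big_seq_cond [RHS]big_seq_cond; apply: eq_bigr => d /andP[].
  rewrite -dvdn_divisors // => dn ned; rewrite IH //.
  - by rewrite ltn_neqAle ned dvdn_leq.
  - exact: dvdn_gt0 dn.
  - by apply: contra pn => /dvdn_trans; apply.
apply: mulIf; apply/monic_neq0/monic_prod => d _.
by rewrite monicMl ?Cyclotomic_monic.
Qed.

Lemma real_Phi_mul_prime (R : realType) (n p : nat) :
    (0 < n)%N -> prime p -> ~~ (p %| n)%N ->
  real_Phi R (n * p) * real_Phi R n = real_Phi R n \Po 'X^p.
Proof.
move=> n0 pp pn; rewrite /real_Phi -rmorphM /= Cyclotomic_mul_prime //.
by rewrite map_comp_poly map_polyXn.
Qed.

Lemma real_Phi1 (R : realType) : real_Phi R 1 = 'X - 1.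
Proof.
have := prod_Cyclotomic (isT : (0 < 1)%N).
by rewrite big_seq1 expr1 /real_Phi => ->; rewrite rmorphB /= map_polyX rmorph1.
Qed.

(** * Counting real roots of a polynomial *)

(** The polynomial is positive just after [x] and negative just before [y].
    Algebraically: dividing by [(X - x)(X - y)] turns the two positive
    derivatives into opposite signs of the quotient. *)
Lemma root_between_crossings (R : rcfType) (P : {poly R}) (x y : R) :
  x < y -> root P x -> root P y -> 0 < P^`().[x] -> 0 < P^`().[y] ->
  exists2 w, w \in `]x, y[ & root P w.
Proof.
move=> xy rx ry.
have [Q ->] : exists Q, P = ('X - x%:P) * ('X - y%:P) * Q.
  have /factor_theorem[Q1 D1] := rx; move: ry.
  rewrite D1 rootM root_XsubC (gt_eqF xy) orbF.
  by move=> /factor_theorem[Q2 ->]; exists Q2; ring.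
rewrite !derivM !derivXsubC !hornerE /= !subrr => Px Py.
have Qx : Q.[x] < 0 by nra.
have Qy : 0 < Q.[y] by nra.
have [|w wI rw] := poly_ivtoo (p := Q) (ltW xy); first by rewrite nmulr_rlt0.
by exists w; rewrite // rootM rw orbT.
Qed.

(** Two upward crossings have a root strictly between them, which is again an
    upward crossing; this descent cannot go on, as there are finitely many
    roots. *)
Lemma unique_crossing (R : rcfType) (P : {poly R}) (x y : R) :
    (forall w, x <= w <= y -> root P w -> 0 < P^`().[w]) ->
  x <= y -> root P x -> root P y -> x = y.
Proof.
have [n] := ubnP (size (roots P x y)); elim: n y => // n IH y sz up.
rewrite le_eqVlt => /predU1P[//|xy] rx ry.
have Px : 0 < P^`().[x] by apply: up; rewrite ?lexx ?ltW.
have Py : 0 < P^`().[y] by apply: up; rewrite ?lexx ?ltW.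
have P0 : P != 0 by apply: contraTneq Px => ->; rewrite deriv0 horner0 ltxx.
have [w wI rw] := root_between_crossings xy rx ry Px Py.
move: (wI); rewrite in_itv /= => /andP[xw wy].
suff E : x = w by rewrite E ltxx in xw.
apply: IH => //; last by exact: ltW.
- rewrite -ltnS; apply: leq_trans sz; rewrite ltnS.
  have /(uniq_leq_size _) : {subset w :: roots P x w <= roots P x y}.
    move=> t; rewrite inE => /predU1P[->|]; first by rewrite root_in_roots.
    move=> tr; rewrite root_in_roots // ?(root_roots tr) //.
    have := roots_in tr; rewrite !in_itv /= => /andP[-> tw].
    exact: lt_trans tw wy.
  apply; rewrite /= uniq_roots andbT; apply/negP => /roots_in.
  by rewrite in_itv /= ltxx andbF.
- move=> t /andP[xt tw]; apply: up; rewrite xt /=.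
  exact: le_trans tw (ltW wy).
Qed.

(** The roots are counted by sorting them into disjoint regions indexed by [J],
    each of which contains exactly one. The regions carry no order, so no
    enumeration of the roots is needed. *)
Lemma size_rootsR_bij (R : rcfType) (T : eqType) (J : seq T) (P : {poly R})
    (I : T -> R -> Prop) :
    P != 0 -> uniq J ->
    (forall j, j \in J -> exists2 x, I j x & root P x) ->
    (forall j x y, j \in J -> I j x -> I j y -> root P x -> root P y -> x = y)
      ->
    (forall i j x, i \in J -> j \in J -> I i x -> I j x -> i = j) ->
    (forall x, root P x -> exists2 j, j \in J & I j x) ->
  size (rootsR P) = size J.
Proof.
move=> P0 uJ exI unI disj cov.
have memR x : (x \in rootsR P) = root P x.
  by have := roots_on_rootsR P0 x; rewrite in_itv.
have [f fP] : {f : T -> R & forall j, j \in J -> I j (f j) /\ root P (f j)}.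
  apply: (boolp.choice (P := fun j x => _ -> I j x /\ root P x)) => j.
  have [/exI[x Ix rx]|nj] := boolP (j \in J).
    by exists x.
  by exists 0.
rewrite -(size_map f); apply: perm_size; apply: uniq_perm.
- exact: uniq_roots.
- rewrite map_inj_in_uniq // => i j iJ jJ E.
  by apply: (disj _ _ (f i)) => //; [case: (fP i iJ)|rewrite E;
    case: (fP j jJ)].
move=> x; rewrite memR; apply/idP/mapP => [rx|[j jJ ->]].
  have [j jJ Ix] := cov x rx; exists j => //.
  by have [If rf] := fP j jJ; apply: (unI j).
by case: (fP j jJ).
Qed.

Lemma mup_simple (R : fieldType) (P : {poly R}) (x : R) :
  root P x -> P^`().[x] != 0 -> mup x P = 1%N.
Proof.
move=> rx dx; have P0 : P != 0.
  by apply: contraNneq dx => ->; rewrite deriv0 horner0.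
apply/eqP; rewrite eqn_leq -ltnS mup_ltn // -XsubC_dvd // dvdp_XsubCl rx andbT.
apply: contra dx => /dvdpP[Q ->].
rewrite expr2 mulrA derivM derivXsubC !hornerE /= subrr.
by rewrite mulr0 add0r mulr0.
Qed.

Lemma unique_crossing_signed (R : rcfType) (e : R) (P : {poly R}) (x y : R) :
    (forall w, x <= w <= y -> root P w -> 0 < e * P^`().[w]) ->
  x <= y -> root P x -> root P y -> x = y.
Proof.
move=> up xy rx ry; have e0 : e != 0.
  by apply/eqP => e0; have := up x; rewrite lexx xy e0 mul0r ltxx => /(_ isT
    rx).
apply: (@unique_crossing _ (e *: P)) => //; rewrite ?rootZ //.
by move=> w /up; rewrite rootZ // derivZ hornerZ.
Qed.

Lemma ivt_signed (R : rcfType) (e : R) (P : {poly R}) (x y : R) :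
    x <= y -> e * P.[x] <= 0 -> 0 <= e * P.[y] -> e != 0 ->
  exists2 w, x <= w <= y & root P w.
Proof.
move=> xy ex ey e0.
have [|w] := @poly_ivt _ (e *: P) _ _ xy; first by rewrite !hornerZ ex.
by rewrite rootZ //; exists w.
Qed.

(** * Odd powers and decay of powers *)

Lemma ltr_odd_exp (R : realDomainType) (p : nat) :
  odd p -> {mono (fun x : R => x ^+ p) : x y / x < y}.
Proof.
move=> op; apply: leW_mono; apply: le_mono => x y xy.
have p0 : (p != 0)%N by case: p op.
have [x0|x0] := lerP 0 x.
  by rewrite ltrXn2r // (le_trans x0 (ltW xy)).
have [y0|y0] := lerP 0 y.
  by apply: (@lt_le_trans _ _ 0); rewrite ?exprn_odd_lt0 ?exprn_odd_ge0.
have oN (t : R) : t ^+ p = - (- t) ^+ p.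
  by rewrite exprNn -signr_odd op expr1 mulN1r opprK.
by rewrite (oN x) (oN y) ltrN2 ltrXn2r ?oppr_ge0 ?ltW // ltrN2.
Qed.

Lemma ler_odd_exp (R : realDomainType) (p : nat) :
  odd p -> {mono (fun x : R => x ^+ p) : x y / x <= y}.
Proof. by move=> op x y; rewrite !leNgt ltr_odd_exp. Qed.

Lemma odd_root (R : rcfType) (p : nat) (a : R) : odd p -> exists x, x ^+ p = a.
Proof.
case: p => // p op; have [a0|a0|->] := ltrgt0P a.
- by have [x _ <-] := nth_root p a0; exists x.
- have [|x _ xa] := @nth_root R (- a) p; first by rewrite oppr_gt0.
  by exists (- x); rewrite exprNn xa -signr_odd op expr1 mulN1r opprK.
- by exists 0; rewrite expr0n.
Qed.

Lemma bernoulli (R : realDomainType) (t : R) (q : nat) :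
  0 <= t -> 1 + q%:R * t <= (1 + t) ^+ q.
Proof.
move=> t0; elim: q => [|q IH]; first by rewrite mul0r addr0 expr0.
rewrite exprS -natr1; have q0 : 0 <= q%:R :> R by exact: ler0n.
have : 0 <= q%:R * t * t by rewrite !mulr_ge0.
by nra.
Qed.

(** With [r = u^3], Bernoulli gives [p u^p <= 1/t] for [u = 1/(1 + t)], so that
    [p^2 r^p <= 1/(p t^3)]. *)
Lemma sqr_geometric_small (R : realType) (r e : R) : 0 < r < 1 -> 0 < e ->
  exists P, forall p, (P <= p)%N -> p%:R ^+ 2 * r ^+ p.-1 < e.
Proof.
move=> /andP[r0 r1] e0; have [u u0 ur] := nth_root 2 r0.
have u1 : u < 1.
  rewrite ltNge; apply/negP => u1.
  by have := exprn_ege1 3 u1; rewrite ur; lra.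
pose t := u^-1 - 1; have t0 : 0 < t by rewrite subr_gt0 invf_gt1.
have tu : 1 + t = u^-1 by rewrite /t addrC subrK.
have K0 : 0 < r * e * t ^+ 3 by rewrite !mulr_gt0 // exprn_gt0.
exists (Num.truncn (r * e * t ^+ 3)^-1).+1 => p Pp.
have pK : (r * e * t ^+ 3)^-1 < p%:R.
  apply: lt_le_trans (truncnS_gt _) _; by rewrite ler_nat.
have {Pp} p0 : (0 < p)%N by apply: leq_ltn_trans Pp.
have pr : 0 < p%:R :> R by rewrite ltr0n.
have ut : u ^+ p * (p%:R * t) <= 1.
  have := bernoulli p (ltW t0); rewrite tu exprVn => B.
  have up : 0 < u ^+ p by rewrite exprn_gt0.
  rewrite -ler_pdivlMl // mulr1; lra.
rewrite -(ltr_pM2r r0) -mulrA -exprSr prednK // -ur exprAC.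
have v0 : 0 < u ^+ p by rewrite exprn_gt0.
set v := u ^+ p in ut v0 *.
have w0 : 0 < v * (p%:R * t) by rewrite !mulr_gt0.
have w3 : (v * (p%:R * t)) ^+ 3 <= 1 by rewrite exprn_ile1 // ltW.
have pK' : 1 < p%:R * (r * e * t ^+ 3) by rewrite -ltr_pdivrMr // mul1r.
rewrite ur.
have tp : 0 < p%:R * t ^+ 3 by rewrite mulr_gt0 // exprn_gt0.
rewrite -(ltr_pM2r tp).
have -> : p%:R ^+ 2 * v ^+ 3 * (p%:R * t ^+ 3) = (v * (p%:R * t)) ^+ 3 by ring.
by apply: (le_lt_trans w3); move: pK'; congr (_ < _); ring.
Qed.

(** * Uniform estimates for continuous functions *)

(** Turns finitely many statements that each hold for small radii into one
    radius that serves all of them. *)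
Lemma common_radius (R : realDomainType) (T : eqType) (s : seq T)
    (P : T -> R -> Prop) :
    (forall z d d', 0 < d' <= d -> P z d -> P z d') ->
    (forall z, z \in s -> exists2 d, 0 < d & P z d) ->
  exists2 d, 0 < d & forall z, z \in s -> P z d.
Proof.
move=> mono; elim: s => [|z s IH] ex; first by exists 1.
have [d d0 Pd] : exists2 d, 0 < d & forall z, z \in s -> P z d.
  by apply: IH => t ts; apply: ex; rewrite inE ts orbT.
have [e e0 Pe] := ex z (mem_head _ _).
have m0 : 0 < Num.min d e by rewrite lt_min d0.
exists (Num.min d e) => // t; rewrite inE => /predU1P[->|ts].
  by apply: mono Pe; rewrite m0 ge_min lexx orbT.
by apply: mono (Pd t ts); rewrite m0 ge_min lexx.
Qed.

Lemma separated_seq (R : realFieldType) (s : seq R) :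
  exists2 d, 0 < d & forall z z', z \in s -> z' \in s -> z != z' -> 2 * d < `|z
    - z'|.
Proof.
have [|z zs|d d0 H] := @common_radius R _ s
    (fun z d => forall z', z' \in s -> z != z' -> 2 * d < `|z - z'|).
- by move=> z d d' /andP[d0 dd'] H z' z's /(H z' z's); apply: le_lt_trans; lra.
- apply: (@common_radius R _ s (fun z' d => z != z' -> 2 * d < `|z - z'|)).
    by move=> z' d d' /andP[d0 dd'] H /H; apply: le_lt_trans; lra.
  move=> z' _; have [<-|zz'] := eqVneq z z'; first by exists 1.
  have n0 : 0 < `|z - z'| by rewrite normr_gt0 subr_eq0.
  by exists (`|z - z'| / 3) => [|_]; lra.
by exists d => // z z' zs; apply: H.
Qed.

Section Continuous.
Variables (R : realType) (F : R -> R).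
Hypothesis cF : continuous F.

Lemma bounded_unit_itv : exists2 C, 0 < C & forall x, `|x| <= 1 -> `|F x| <= C.
Proof.
have [||u _ H] := @EVT_max R (fun x => `|F x|) (-1) 1; first by lra.
- apply: continuous_subspaceT => x.
  exact: (continuous_comp (@cF x) (@norm_continuous _ _ (F x))).
exists (`|F u| + 1) => [|x]; first by rewrite ltr_wpDl.
rewrite ler_norml => x1; apply: le_trans (H x _) _; first by rewrite in_itv.
by rewrite lerDl.
Qed.

Lemma sign_near (s : seq R) : (forall z, z \in s -> F z != 0) ->
  exists2 d, 0 < d &
    forall z x, z \in s -> `|x - z| <= d -> d <= Num.sg (F z) * F x.
Proof.
move=> Fs; have [|z zs|d d0 H] := @common_radius R _ s
    (fun z d => forall x, `|x - z| <= d -> d <= Num.sg (F z) * F x).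
- move=> z d d' /andP[d0 dd'] H x xz; apply: (le_trans dd' (H x _)).
  exact: le_trans xz dd'.
- have Fz : 0 < `|F z| / 2 by rewrite divr_gt0 // normr_gt0 Fs.
  have /cvgrPdist_le/(_ _ Fz)/nbhs_ballP[e /= e0 He] := @cF z.
  exists (Num.min (e / 2) (`|F z| / 2)); first by rewrite lt_min Fz andbT; lra.
  move=> x; rewrite le_min => /andP[xe _].
  have /= : `|F z - F x| <= `|F z| / 2.
    by apply: He; rewrite /ball /= distrC; lra.
  rewrite ge_min => FF; apply/orP; right.
  have := Fs z zs; rewrite neq_lt => /orP[] Fz0.
    rewrite ltr0_sg //; move: FF; rewrite (ltr0_norm Fz0) ler_norml; lra.
  rewrite gtr0_sg //; move: FF; rewrite (gtr0_norm Fz0) ler_norml; lra.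
by exists d => // z x zs; apply: H.
Qed.

(** The points at distance at least [d] from the zeros form a compact set. *)
Lemma away_from_zeros (d : R) : 0 < d -> exists2 e, 0 < e &
  forall x, `|x| <= 1 -> (forall z, `|z| <= 1 -> F z = 0 -> d <= `|x - z|) ->
    e <= `|F x|.
Proof.
move=> d0; pose K := `[-1, 1]%classic `&` \bigcap_(z in [set z | `|z| <= 1 /\ F
  z = 0])
  ((fun x => `|x - z|) @^-1` [set y | d <= y]).
have cK : compact K.
  apply: (subclosed_compact _ (@segment_compact R (-1) 1)); last by move=> x [].
  apply: closedI; first exact: itv_closed.
  apply: closed_bigI => z _; apply: preimage_closed; last exact: closed_ge.
  move=> x _; apply: (@continuous_comp _ _ _ (fun x => x - z) Num.norm).
    by apply: cvgB; [exact: cvg_id|exact: cvg_cst].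
  exact: norm_continuous.
have KP x : `|x| <= 1 -> (forall z, `|z| <= 1 -> F z = 0 -> d <= `|x - z|) ->
    K x.
  move=> x1 H; split; first by rewrite /= in_itv /= -ler_norml.
  by move=> z [z1 Fz]; apply: H.
have [K0|K0] := pselect (K !=set0); last first.
  by exists 1 => // x x1 H; exfalso; apply: K0; exists x; apply: KP.
have [|u] := compact_EVT_min (f := fun x => `|F x|) K0 cK.
  apply: continuous_subspaceT => x.
  exact: (continuous_comp (@cF x) (@norm_continuous _ _ (F x))).
rewrite inE => -[]; rewrite /= in_itv /= -ler_norml => u1 uK umin.
exists `|F u| => [|x x1 xz]; last by apply: umin; rewrite inE; apply: KP.
rewrite normr_gt0; apply/eqP => Fu.
by have := uK u (conj u1 Fu); rewrite /= subrr normr0; lra.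
Qed.

End Continuous.

(** * The logarithmic derivative *)

Section LogDerivative.
Variables (R : realType) (f : {poly R}).

(** The derivative of [ln f] with respect to [ln x]: the substitution [x := x^p]
    multiplies it by [p]. *)
Definition xlogder (x : R) : R := x * f^`().[x] / f.[x].

Definition xlogder' (x : R) : R :=
  (f^`().[x] + x * f^`()^`().[x]) / f.[x] - x * (f^`().[x] / f.[x]) ^+ 2.

Hypothesis f_neq0 : forall x, f.[x] != 0.

Lemma is_derive_xlogder (x : R) : is_derive x 1 xlogder (xlogder' x).
Proof.
have dV := is_deriveV (f_neq0 x) (is_derive_poly f x).
have dN := is_deriveM (is_derive_id x (1 : R)) (is_derive_poly f^`() x).
apply: (is_derive_eq (is_deriveM dN dV)); rewrite /xlogder' /GRing.scale /=.
have := f_neq0 x => fx.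
rewrite -[X in X * (- _ * _) + _]/(x * f^`().[x]).
by move: f.[x] f^`().[x] f^`()^`().[x] fx => a b c a0; field.
Qed.

Lemma continuous_xlogder : continuous xlogder.
Proof.
move=> x; apply/differentiable_continuous/derivable1_diffP.
by case: (is_derive_xlogder x).
Qed.

Lemma continuous_xlogder' : continuous xlogder'.
Proof.
have cp (p : {poly R}) x : p.[y] @[y --> x] --> p.[x].
  exact: continuous_horner.
move=> x; have cV : f.[y]^-1 @[y --> x] --> f.[x]^-1.
  exact: (cvgV (f_neq0 x) (cp f x)).
have cx : y @[y --> x] --> x by exact: cvg_id.
have cq := cvgM (cp f^`() x) cV.
have cn := cvgD (cp f^`() x) (cvgM cx (cp f^`()^`() x)).
rewrite /continuous_at /xlogder' expr2; under eq_fun do rewrite expr2.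
exact: (cvgB (cvgM (cn _ _) cV) (cvgM cx (cvgM (cq _) (cq _)))).
Qed.

Lemma xlogder_MVT (z x d : R) : `|x - z| <= d ->
  exists2 u, `|u - z| <= d & xlogder x - xlogder z = xlogder' u * (x - z).
Proof.
have cw (A : set R) : {within A, continuous xlogder}.
  exact/continuous_subspaceT/continuous_xlogder.
rewrite ler_norml => xzd; case: (lerP z x) => zx.
  have [u] := MVT_segment zx (fun t _ => is_derive_xlogder t) (cw _).
  by rewrite in_itv /= => ui E; exists u => //; rewrite ler_norml; lra.
have [u] := MVT_segment (ltW zx) (fun t _ => is_derive_xlogder t) (cw _).
rewrite in_itv /= => ui E; exists u; first by rewrite ler_norml; lra.
by rewrite -[LHS]opprB E -mulrN opprB.
Qed.

End LogDerivative.

(** * The substitution identities *)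

Section Substitution.
Variables (R : realType) (f g : {poly R}) (p : nat).
Hypotheses (f_gt0 : forall x, 0 < f.[x]) (p_gt1 : (1 < p)%N).
Hypothesis gf : g * f = f \Po 'X^p.

Lemma horner_gf x : g.[x] * f.[x] = f.[x ^+ p].
Proof. by rewrite -hornerM gf horner_comp hornerXn. Qed.

Lemma g_gt0 x : 0 < g.[x].
Proof. by rewrite -(pmulr_lgt0 _ (f_gt0 x)) horner_gf. Qed.

Lemma deriv_gf x :
  g^`().[x] * f.[x] + g.[x] * f^`().[x]
  = p%:R * x ^+ p.-1 * f^`().[x ^+ p].
Proof.
have := congr1 (fun P => P^`().[x]) gf; rewrite derivM deriv_comp derivXn.
by rewrite !hornerE horner_comp hornerMn !hornerXn -mulr_natl => ->; ring.
Qed.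

Lemma deriv2_gf x :
  g^`()^`().[x] * f.[x] + 2 * (g^`().[x] * f^`().[x]) + g.[x] * f^`()^`().[x]
  = p%:R * p.-1%:R * x ^+ p.-2 * f^`().[x ^+ p]
    + p%:R ^+ 2 * x ^+ p.-1 ^+ 2 * f^`()^`().[x ^+ p].
Proof.
have E := congr1 (fun P => P^`()^`().[x]) gf.
rewrite !(derivM, derivD, deriv_comp, derivXn, derivMn) in E.
rewrite !(hornerD, hornerM, horner_comp, hornerMn, hornerXn) in E.
rewrite -[x ^+ p.-1 *+ p]mulr_natl -[_ *+ p.-1 *+ p]mulr_natl in E.
rewrite -[x ^+ p.-2 *+ p.-1]mulr_natl in E.
rewrite [RHS](_ : _ = f^`()^`().[x ^+ p] * (p%:R * x ^+ p.-1) * (p%:R * x ^+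
  p.-1)
  + f^`().[x ^+ p] * (p%:R * (p.-1%:R * x ^+ p.-2))); last by ring.
by rewrite -E; ring.
Qed.

(** The nonzero critical points of [g] are the solutions of [p h(x^p) = h(x)],
    where [h] is [xlogder f]. *)
Lemma xderiv_g x :
  x * g^`().[x] = g.[x] * (p%:R * xlogder f (x ^+ p) - xlogder f x).
Proof.
have := deriv_gf x; have := horner_gf x; rewrite /xlogder.
have fx := lt0r_neq0 (f_gt0 x); have gx := lt0r_neq0 (g_gt0 x).
have ps : x ^+ p = x * x ^+ p.-1 by rewrite -exprS prednK // ltnW.
move: (x ^+ p) ps => s ps <- E; apply: (mulIf fx).
have -> : x * g^`().[x] * f.[x]
    = x * (g^`().[x] * f.[x] + g.[x] * f^`().[x]) - x * g.[x] * f^`().[x].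
  by ring.
by rewrite E ps; field; rewrite fx.
Qed.

(** At a critical point [x^2 g'' / g] is the derivative of [x g' / g] along [x
    d/dx], which is what differentiating [p h(x^p) - h(x)] gives. *)
Lemma xderiv2_g x : root g^`() x ->
  x ^+ 2 * g^`()^`().[x]
  = g.[x] * (p%:R ^+ 2 * x ^+ p * xlogder' f (x ^+ p) - x * xlogder' f x).
Proof.
move=> /rootP rx; have := deriv2_gf x; have := deriv_gf x; rewrite rx.
have := horner_gf x; rewrite /xlogder'.
have fx := lt0r_neq0 (f_gt0 x); have gx := lt0r_neq0 (g_gt0 x).
case: p p_gt1 => [|[|q]] //= _; rewrite -[q.+2%:R]natr1 -[q.+1%:R]natr1.
rewrite ![_ ^+ q.+2]exprS ![_ ^+ q.+1]exprS; move: (x ^+ q) => y <-.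
move: (f^`().[x * (x * y)]) (f^`()^`().[x * (x * y)]) => F1 F2 E2 E3.
move: f.[x] f^`().[x] f^`()^`().[x] g.[x] g^`()^`().[x] fx gx E2 E3.
move=> a a1 a2 c c2 a0 c0 E2 E3.
have {}E2 : (q%:R + 1 + 1) * (x * (x * y)) * F1 - x * c * a1 = 0.
  by transitivity (x * ((q%:R + 1 + 1) * (x * y) * F1 - (0 * a + c * a1)));
    [ring|rewrite E2; ring].
apply: (mulIf a0).
have -> : x ^+ 2 * c2 * a = x ^+ 2 * (c2 * a + 2 * (0 * a1) + c * a2) - x ^+ 2
  * c * a2 by ring.
rewrite E3.
(* The two sides differ by a multiple of the vanishing quantity in [E2]. *)
rewrite -[LHS]addr0 -(mul0r (1 - ((q%:R + 1 + 1) * (x * (x * y)) * F1 + x * c *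
  a1) / (c * a))) -E2.
by field; rewrite a0 c0.
Qed.

End Substitution.

(** * The inductive invariant and its constants *)

(** What an induction step needs from the previous polynomial. The two-sided
    bound [sc_outer] replaces the knowledge that the roots of [f] lie on the
    unit circle: it reproduces itself by [p h(x^p) - h(x)] as soon as [p c > C],
    and it keeps the critical points inside [(-1, 1)]. *)
Record simple_critical (R : realType) (f : {poly R}) (m : nat) : Prop :=
  SimpleCritical {
    sc_gt0 : forall x, 0 < f.[x];
    sc_deriv0 : f^`().[0] != 0;
    sc_outer : exists c C, 0 < c /\
      forall x, 1 <= `|x| -> c <= xlogder f x <= C;
    sc_simple : forall x, root f^`() x -> f^`()^`().[x] != 0;
    sc_size : size (rootsR f^`()) = m }.

(** [d] is the radius of disjoint neighbourhoods of [0], [1], [-1] and the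
    critical points; [c] and [C] bound [xlogder f] and its derivative from below
    and above wherever this is needed. Near a zero of [xlogder f] it is the
    derivative that is bounded below, with a constant sign. *)
Record adapted (R : realType) (f : {poly R}) (d c C : R) : Prop := Adapted {
  ad_d0 : 0 < d;
  ad_c0 : 0 < c;
  ad_sep : forall z z', z \in [:: 1, -1, 0 & rootsR f^`()] ->
    z' \in [:: 1, -1, 0 & rootsR f^`()] -> z != z' -> 2 * d < `|z - z'|;
  ad_sign : forall z x, z \in 0 :: rootsR f^`() -> `|x - z| <= d ->
    c <= Num.sg (xlogder' f z) * xlogder' f x;
  ad_outer : forall x, 1 - d <= `|x| -> c <= xlogder f x;
  ad_bound : forall x, 1 <= `|x| -> xlogder f x <= C;
  ad_bound0 : forall x, `|x| <= 1 -> `|xlogder f x| <= C;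
  ad_bound1 : forall x, `|x| <= 1 -> `|xlogder' f x| <= C;
  ad_away : forall x, `|x| <= 1 ->
    (forall z, z \in 0 :: rootsR f^`() -> d <= `|x - z|) -> c <= `|xlogder f x|
      }.

Section Critical.
Variables (R : realType) (f : {poly R}) (m : nat).
Hypothesis fm : simple_critical f m.

Lemma sc_neq0 x : f.[x] != 0.
Proof. by rewrite lt0r_neq0 // (sc_gt0 fm). Qed.

Lemma mem_critical z : (z \in rootsR f^`()) = root f^`() z.
Proof.
have f'0 : f^`() != 0.
  by apply: contraNneq (sc_deriv0 fm) => ->; rewrite horner0.
by have := roots_on_rootsR f'0 z; rewrite in_itv.
Qed.

Lemma xlogder_eq0 z : (xlogder f z == 0) = (z \in 0 :: rootsR f^`()).
Proof.
rewrite /xlogder mulf_eq0 invr_eq0 (negbTE (sc_neq0 z)) orbF mulf_eq0.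
by rewrite inE mem_critical.
Qed.

(** The origin and the simple roots of [f'] are simple zeros of [xlogder f]. *)
Lemma xlogder'_neq0 z : z \in 0 :: rootsR f^`() -> xlogder' f z != 0.
Proof.
rewrite inE mem_critical /xlogder' => /predU1P[->|rz].
  rewrite !mul0r subr0 addr0 mulf_neq0 ?invr_eq0 ?sc_neq0 //.
  exact: (sc_deriv0 fm).
rewrite (rootP rz) add0r mul0r expr2 !mulr0 subr0 !mulf_neq0 ?invr_eq0 //.
- by apply: contraNneq (sc_deriv0 fm) => z0; apply/eqP;
    rewrite -[in LHS]z0 (rootP rz).
- exact: (sc_simple fm).
- exact: sc_neq0.
Qed.

Lemma adapted_exists : exists d c C, adapted f d c C.
Proof.
have f0 := sc_neq0.
have ch := continuous_xlogder f0; have cb := continuous_xlogder' f0.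
have [c1 [C1 [c10 outer]]] := sc_outer fm.
have [d1 d10 sep] := separated_seq [:: 1, -1, 0 & rootsR f^`()].
have [d2 d20 sgn] := sign_near cb xlogder'_neq0.
have [|d3 d30 near1] := sign_near ch (s := [:: 1; -1]).
  move=> z zs; have /outer : 1 <= `|z|.
    by move: zs; rewrite !inE => /orP[] /eqP->; rewrite ?normrN normr1.
  by move=> /andP[h _]; rewrite lt0r_neq0 // (lt_le_trans c10).
have [C2 C20 bd0] := bounded_unit_itv ch.
have [C3 C30 bd1] := bounded_unit_itv cb.
pose d := Num.min d1 (Num.min d2 d3).
have d0 : 0 < d by rewrite !lt_min d10 d20.
have [dd1 dd2 dd3] : [/\ d <= d1, d <= d2 & d <= d3].
  by rewrite /d !ge_min !lexx !orbT.
have [c4 c40 away] := away_from_zeros ch d0.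
pose c := Num.min (Num.min c1 d2) (Num.min d3 c4).
have c0 : 0 < c by rewrite !lt_min c10 d20 d30.
have [cc1 cc2 cc3 cc4] : [/\ c <= c1, c <= d2, c <= d3 & c <= c4].
  by rewrite /c !ge_min !lexx !orbT.
pose C := Num.max C1 (Num.max C2 C3).
have [CC1 CC2 CC3] : [/\ C1 <= C, C2 <= C & C3 <= C].
  by rewrite /C !le_max !lexx !orbT.
exists d, c, C; split => //.
- by move=> z z' zs z's /(sep _ _ zs z's); apply: le_lt_trans; lra.
- move=> z x zs xz; apply: (le_trans cc2); apply: sgn => //;
    exact: le_trans dd2.
- move=> x dx; have [x1|x1] := lerP 1 `|x|.
    by have /andP[+ _] := outer x x1; apply: le_trans.
  have [x0|x0] := lerP 0 x.
    have := near1 1 x; rewrite inE eqxx => /(_ isT).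
    have /outer/andP[h1 _] : 1 <= `|1 : R| by rewrite normr1.
    rewrite gtr0_sg ?(lt_le_trans c10) // mul1r => H; apply: (le_trans cc3).
    by apply: H; apply: le_trans dd3; rewrite ger0_norm // in x1 dx;
      rewrite ler_norml; lra.
  have := near1 (-1) x; rewrite !inE eqxx orbT => /(_ isT).
  have /outer/andP[h1 _] : 1 <= `|-1 : R| by rewrite normrN normr1.
  rewrite gtr0_sg ?(lt_le_trans c10) // mul1r => H; apply: (le_trans cc3).
  by apply: H; apply: le_trans dd3; rewrite ltr0_norm // in x1 dx;
    rewrite ler_norml; lra.
- by move=> x /outer/andP[_ h]; apply: (le_trans h).
- by move=> x /bd0 h; apply: (le_trans h).
- by move=> x /bd1 h; apply: (le_trans h).
- move=> x x1 H; apply: (le_trans cc4); apply: away => // z _ /eqP.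
  by rewrite xlogder_eq0; apply: H.
Qed.

End Critical.

Lemma adapted_half (R : realType) (f : {poly R}) (d c C : R) :
  adapted f d c C -> 2 * d < 1.
Proof.
move=> ad; have := ad_sep ad (z := 1) (z' := 0).
by rewrite !inE !eqxx !orbT oner_eq0 subr0 normr1; apply.
Qed.

Lemma adapted_le (R : realType) (f : {poly R}) (d c C : R) :
  adapted f d c C -> c <= C.
Proof.
move=> ad; have h1 : 1 <= `|1 : R| by rewrite normr1.
apply: le_trans (ad_bound ad h1); apply: (ad_outer ad); rewrite normr1.
by rewrite gerBl ltW // (ad_d0 ad).
Qed.

(** * The critical points after adding a large prime *)

Section Step.
Variables (R : realType) (f g : {poly R}) (m p : nat) (d c C : R).
Hypotheses (fm : simple_critical f m) (ad : adapted f d c C).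
Hypotheses (op : odd p) (p_gt1 : (1 < p)%N).
Hypothesis gf : g * f = f \Po 'X^p.

Local Notation h := (xlogder f).
Local Notation b := (xlogder' f).
Local Notation crit := (rootsR f^`()).
Local Notation n := (p%:R : R).
Local Notation rho := (1 - d).
Local Notation r := ((1 - d) ^+ p.-1).

(** [large1] makes the terms in [x^p] dominate near the unit circle, [large2]
    makes them negligible for [|x| <= rho]. *)
Hypothesis large1 : C ^+ 2 < n * d * c ^+ 2.
Hypothesis large2 : n ^+ 2 * r * C < d * c.

Let f_gt0 x : 0 < f.[x]. Proof. exact: sc_gt0 fm x. Qed.
Let d0 : 0 < d. Proof. exact: ad_d0 ad. Qed.
Let c0 : 0 < c. Proof. exact: ad_c0 ad. Qed.

Let d_half : 2 * d < 1. Proof. exact: adapted_half ad. Qed.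
Let cC : c <= C. Proof. exact: adapted_le ad. Qed.

Let C0 : 0 < C. Proof. exact: lt_le_trans c0 cC. Qed.

Let n1 : 1 <= n. Proof. by rewrite ler1n ltnW. Qed.

Let r0 : 0 < r. Proof. have D1 := d_half; by rewrite exprn_gt0 //; lra. Qed.

Let nrC : n * r * C < d * c.
Proof.
apply: le_lt_trans large2; rewrite ler_pM2r // ler_pM2r // expr2 ler_peMl //.
Qed.

Let rd : r < d.
Proof.
have : r * C < d * C.
  apply: le_lt_trans (_ : n * r * C < _).
    by rewrite ler_pM2r // ler_peMl // ltW.
  by apply: (lt_le_trans nrC); rewrite ler_pM2l.
by rewrite ltr_pM2r.
Qed.

Let nc_gt : C < n * c * d.
Proof.
rewrite -(ltr_pM2r C0) -expr2; apply: (lt_le_trans large1).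
have nd : 0 < n * c * d by rewrite !mulr_gt0 // (lt_le_trans _ n1).
have -> : n * d * c ^+ 2 = n * c * d * c by ring.
by rewrite ler_pM2l.
Qed.

Let nc_gt1 : C < n * c.
Proof.
apply: (lt_le_trans nc_gt); have nc : 0 < n * c by rewrite mulr_gt0 //
  (lt_le_trans _ n1).
by have [D0 D1] := (d0, d_half); rewrite ger_pMr //; lra.
Qed.

Let ncc : C ^+ 2 < n * c ^+ 2.
Proof.
apply: (lt_le_trans large1); have nc : 0 < n * c ^+ 2.
  by rewrite mulr_gt0 ?exprn_gt0 // (lt_le_trans _ n1).
have -> : n * d * c ^+ 2 = n * c ^+ 2 * d by ring.
by have [D0 D1] := (d0, d_half); rewrite ger_pMr //; lra.
Qed.

Let pow_small (x : R) : `|x| <= rho -> `|x ^+ p| <= r * `|x|.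
Proof.
have D1 := d_half; move=> xr; rewrite normrX -[in leLHS](prednK (ltnW p_gt1))
  exprSr.
by rewrite ler_wpM2r // lerXn2r // nnegrE; [|lra].
Qed.

Let pow_unit (x : R) : `|x| <= 1 -> `|x ^+ p| <= 1.
Proof. by move=> x1; rewrite normrX exprn_ile1. Qed.

Let pow_unit_inv (x : R) : `|x ^+ p| <= 1 -> `|x| <= 1.
Proof.
rewrite normrX; apply: contra_le => x1; rewrite -(expr1n _ p).
by rewrite ltrXn2r // -lt0n ltnW.
Qed.

Let h_Z (z : R) : z \in 0 :: crit -> h z = 0.
Proof. by rewrite -(xlogder_eq0 fm) => /eqP. Qed.

Let h_lip x : `|x| <= 1 -> `|h x| <= C * `|x|.
Proof.
move=> x1; have [|u] := xlogder_MVT (sc_neq0 fm) (z := 0) (x := x) (d := `|x|).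
  by rewrite subr0.
rewrite (h_Z (mem_head _ _)) !subr0 => ux ->; rewrite normrM ler_wpM2r //.
by apply: (ad_bound1 ad); apply: le_trans x1.
Qed.

Let h_near z x : z \in 0 :: crit -> `|x - z| <= d ->
  exists2 t, h x = t * (x - z) & c <= Num.sg (b z) * t.
Proof.
move=> zZ xz; have [u uz] := xlogder_MVT (sc_neq0 fm) xz.
by rewrite (h_Z zZ) subr0 => hx; exists (b u) => //; apply: (ad_sign ad).
Qed.

Let Z_lt1 z : z \in crit -> `|z| < 1.
Proof.
have D0 := d0; move=> zZ; rewrite ltNge; apply/negP => z1.
have : c <= h z by apply: (ad_outer ad); apply: le_trans z1; lra.
by rewrite h_Z ?inE ?zZ ?orbT // leNgt c0.
Qed.

Let Z_far0 z : z \in crit -> 2 * d < `|z|.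
Proof.
move=> zZ; have := ad_sep ad (z := z) (z' := 0).
rewrite !inE zZ !eqxx !orbT subr0; apply => //.
apply: contraTneq zZ => ->; rewrite (mem_critical fm).
by rewrite /root (sc_deriv0 fm).
Qed.

Let Z_far1 z : z \in crit -> `|z| < 1 - 2 * d.
Proof.
have D0 := d0; move=> zZ; have z1 := Z_lt1 zZ; move: (z1);
  rewrite ltr_norml => /andP[z1l z1r].
have := ad_sep ad (z := z) (z' := 1); rewrite !inE zZ !eqxx !orbT.
move=> /(_ isT isT); rewrite lt_eqF // => /(_ isT) A.
have := ad_sep ad (z := z) (z' := -1); rewrite !inE zZ !eqxx !orbT.
move=> /(_ isT isT); rewrite gt_eqF // => /(_ isT) B.
rewrite ltr0_norm in A; last by lra.
rewrite opprK gtr0_norm in B; last by lra.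
by rewrite ltr_norml; lra.
Qed.

Let root_eq x : root g^`() x -> n * h (x ^+ p) = h x.
Proof.
move=> /rootP rx; have := xderiv_g f_gt0 p_gt1 gf x; rewrite rx mulr0.
move=> /esym/eqP; rewrite mulf_eq0 gt_eqF /= ?(g_gt0 f_gt0 gf) // subr_eq0.
by move/eqP.
Qed.

Let sg_le1 (x : R) : `|Num.sg x| <= 1.
Proof. by rewrite normr_sg; case: eqP. Qed.

(** In the inner part [|x| <= rho] the terms that contain [x^p] are negligible.
    *)
Let small_h (a x : R) : `|a| <= 1 -> `|x| <= rho ->
  `|a * (n * h (x ^+ p))| <= n * r * C.
Proof.
have D0 := d0; move=> a1 xr; have x1 : `|x| <= 1 by lra.
have N0 : 0 <= n by exact: le_trans n1.
rewrite normrM -[leRHS]mul1r ler_pM // normrM (ger0_norm N0) -mulrA.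
rewrite ler_wpM2l // mulrC; apply: (le_trans (h_lip (pow_unit x1))).
rewrite ler_pM2l //; apply: (le_trans (pow_small xr)).
by rewrite ler_piMr // ltW.
Qed.

Let small_b (a x : R) : `|a| <= 1 -> `|x| <= rho ->
  `|a * (n ^+ 2 * x ^+ p * b (x ^+ p))| <= n ^+ 2 * r * C.
Proof.
have D0 := d0; move=> a1 xr; have x1 : `|x| <= 1 by lra.
have N0 : 0 <= n by exact: le_trans n1.
rewrite normrM -[leRHS]mul1r ler_pM // normrM.
rewrite ler_pM ?(ad_bound1 ad) ?pow_unit // normrM normrX (ger0_norm N0).
rewrite ler_wpM2l ?exprn_ge0 //; apply: (le_trans (pow_small xr)).
by rewrite ler_piMr // ltW.
Qed.

(** The factor [a] keeps track of the sign of [x]. *)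
Let deriv_sign (a e x : R) : 0 < a * x ->
  0 < e * (n * h (x ^+ p) - h x) -> 0 < a * e * g^`().[x].
Proof.
move=> ax eT; have x0 : x != 0 by apply: contraTneq ax => ->;
  rewrite mulr0 ltxx.
have x2 : 0 < x ^+ 2 by rewrite exprn_even_gt0.
rewrite -(pmulr_rgt0 _ x2).
have -> : x ^+ 2 * (a * e * g^`().[x]) = a * x * (e * (x * g^`().[x])) by ring.
rewrite (xderiv_g f_gt0 p_gt1 gf) pmulr_rgt0 // mulrCA pmulr_rgt0 //.
exact: (g_gt0 f_gt0 gf).
Qed.

Let crossing_sign (e x : R) : root g^`() x -> x != 0 ->
  0 < e * (n ^+ 2 * x ^+ p * b (x ^+ p) - x * b x) ->
  0 < e * g^`()^`().[x].
Proof.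
move=> rx x0 eT; have x2 : 0 < x ^+ 2 by rewrite exprn_even_gt0.
rewrite -(pmulr_rgt0 _ x2) mulrCA (xderiv2_g f_gt0 p_gt1 gf rx) mulrCA.
by rewrite pmulr_rgt0 // (g_gt0 f_gt0 gf).
Qed.

Let near_sg (z x : R) : 2 * d < `|z| -> `|x - z| <= d ->
  Num.sg z * x = `|x| /\ d <= `|x|.
Proof.
have D0 := d0; rewrite ler_norml; have [z0|z0|->] := ltrgt0P z => zd xz.
- by rewrite gtr0_sg // mul1r ger0_norm; [split|]; lra.
- by rewrite ltr0_sg // mulN1r ltr0_norm; [split|]; lra.
- by lra.
Qed.

Let near_inner (z x : R) : z \in crit -> `|x - z| <= d -> `|x| < rho.
Proof.
have D0 := d0; move=> /Z_far1; rewrite ltr_norml ler_norml ltr_norml; lra.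
Qed.

Let mem0Z z : z \in crit -> z \in 0 :: crit.
Proof. by move=> zZ; rewrite inE zZ orbT. Qed.

(** The term [- x h'(x)] dominates the sign of [g''] here, and [p^2 s h'(s)] in
    [outer_crossing]; hence the opposite signs. *)
Let inner_crossing (z x : R) : z \in crit -> `|x - z| <= d -> root g^`() x ->
  0 < - (Num.sg z * Num.sg (b z)) * g^`()^`().[x].
Proof.
have D0 := d0; move=> zZ xz rx; have [zx dx] := near_sg (Z_far0 zZ) xz.
apply: crossing_sign => //; first by rewrite -normr_gt0; lra.
have bx := ad_sign ad (mem0Z zZ) xz.
set e := _ * Num.sg (b z); have e1 : `|e| <= 1.
  by rewrite normrM -[leRHS]mulr1 ler_pM.
have := small_b e1 (ltW (near_inner zZ xz)); rewrite ler_norml => /andP[_ sb].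
have := ler_pM (ltW d0) (ltW c0) dx bx; rewrite -zx => big.
have -> : - e * (n ^+ 2 * x ^+ p * b (x ^+ p) - x * b x)
  = Num.sg z * x * (Num.sg (b z) * b x)
    - e * (n ^+ 2 * x ^+ p * b (x ^+ p)) by rewrite /e; ring.
by rewrite subr_gt0; apply: le_lt_trans sb _; exact: lt_le_trans large2 big.
Qed.

(** The sign of [g'] at [z - d] and at [z + d] is that of [- h(x)] times the
    sign of [z], and [h] changes sign at [z]. *)
Let inner_root (z : R) : z \in crit ->
  exists2 x, `|x - z| <= d & root g^`() x.
Proof.
have [[D0 C1] L] := (d0, c0, nrC); move=> zZ.
have close a : `|a| <= 1 -> `|z + a * d - z| <= d.
  by rewrite addrC addKr normrM (gtr0_norm D0) => a1; rewrite ler_piMl // ltW.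
have sgn (a : R) : `|a| = 1 ->
    0 < Num.sg z * (- (Num.sg (b z) * a)) * g^`().[z + a * d].
  move=> a1; have aa : a * a = 1 by rewrite -expr2 -real_normK ?num_real // a1
    expr1n.
  have xz : `|z + a * d - z| <= d by apply: close; rewrite a1.
  have [zx dx] := near_sg (Z_far0 zZ) xz.
  apply: deriv_sign; first by rewrite zx; apply: lt_le_trans dx.
  have [t ht ct] := h_near (mem0Z zZ) xz.
  have e1 : `|Num.sg (b z) * a| <= 1 by rewrite normrM a1 mulr1.
  have := small_h e1 (ltW (near_inner zZ xz)); rewrite ler_norml => /andP[_ sb].
  rewrite ht; have -> (y : R) : - (Num.sg (b z) * a) * (y - t * (z + a * d - z))
     = a * a * (d * (Num.sg (b z) * t)) - Num.sg (b z) * a * y by ring.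
  rewrite aa mul1r subr_gt0; apply: le_lt_trans sb _; apply: lt_le_trans L _.
  by rewrite ler_pM2l.
have := sgn 1; rewrite normr1 mulr1 mul1r => /(_ erefl) A.
have := sgn (-1); rewrite normrN normr1 mulrN1 opprK mulN1r => /(_ erefl) B.
have [||||w /andP[w1 w2] rw] :=
  @ivt_signed _ (Num.sg z * - Num.sg (b z)) g^`() (z - d) (z + d).
- lra.
- by rewrite mulrN mulNr oppr_le0 ltW.
- exact: ltW.
- by apply: contraTneq A => ->; rewrite mul0r ltxx.
by exists w => //; rewrite ler_norml; lra.
Qed.

Let pow_sg (z x : R) : z != 0 -> (0 < Num.sg z * x) = (0 < Num.sg z * x ^+ p).
Proof. by move=> z0; rewrite -(exprn_odd_gt0 _ op) exprMn sgr_odd // op expr1.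
  Qed.

Let outer_region (z x : R) : z \in crit -> `|x ^+ p - z| <= d ->
  [/\ 0 < Num.sg z * x, Num.sg z * x ^+ p = `|x ^+ p|, d <= `|x ^+ p|,
      rho <= `|x| & `|x| <= 1].
Proof.
have [[[D0 D1] D2] D3] := (d0, d_half, rd, r0).
move=> zZ sz; have [zs ds] := near_sg (Z_far0 zZ) sz.
have z0 : z != 0 by rewrite -normr_gt0; have := Z_far0 zZ; lra.
split => //.
- by rewrite pow_sg // zs; apply: lt_le_trans ds.
- rewrite leNgt; apply/negP => xr; have := pow_small (ltW xr).
  have : r * `|x| <= r by rewrite ler_piMr; lra.
  lra.
- by apply: pow_unit_inv; have := near_inner zZ sz; lra.
Qed.

Let outer_crossing (z x : R) : z \in crit -> `|x ^+ p - z| <= d ->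
  root g^`() x -> 0 < Num.sg z * Num.sg (b z) * g^`()^`().[x].
Proof.
have [[[D0 C1] L] N1] := (d0, c0, nc_gt, n1).
move=> zZ sz rx; have [x0 zs ds _ x1] := outer_region zZ sz.
apply: crossing_sign => //.
  by apply: contraTneq x0 => ->; rewrite mulr0 ltxx.
have bs := ad_sign ad (mem0Z zZ) sz.
set e := _ * Num.sg (b z).
have small : `|e * (x * b x)| <= C.
  rewrite normrM -[leRHS]mul1r ler_pM //.
    by rewrite normrM -[leRHS]mulr1 ler_pM.
  by rewrite normrM -[leRHS]mul1r ler_pM // (ad_bound1 ad).
have big := ler_pM (ltW d0) (ltW c0) ds bs.
have -> : e * (n ^+ 2 * x ^+ p * b (x ^+ p) - x * b x)
  = n ^+ 2 * (`|x ^+ p| * (Num.sg (b z) * b (x ^+ p))) - e * (x * b x).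
  by rewrite -zs /e; ring.
have /ler_normlP[_ {}small] := small.
rewrite subr_gt0; apply: le_lt_trans small _; apply: (lt_le_trans L).
have dc0 : 0 < d * c by rewrite mulr_gt0.
have -> : n * c * d = n * (d * c) by ring.
apply: ler_pM big; [exact: ler0n|exact: ltW|].
by rewrite expr2 ler_peMl // ler0n.
Qed.

(** As in [inner_root], at the points whose [p]-th powers are [z - d] and [z +
    d], where now [p h(x^p)] dominates. *)
Let outer_root (z : R) : z \in crit ->
  exists2 x, `|x ^+ p - z| <= d & root g^`() x.
Proof.
have [[[D0 C1] L] N1] := (d0, c0, nc_gt, n1); move=> zZ.
have close a : `|a| <= 1 -> `|z + a * d - z| <= d.
  by rewrite addrC addKr normrM (gtr0_norm D0) => a1; rewrite ler_piMl // ltW.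
have sgn (a x : R) : `|a| = 1 -> x ^+ p = z + a * d ->
    0 < Num.sg z * (Num.sg (b z) * a) * g^`().[x].
  move=> a1 xp; have aa : a * a = 1 by rewrite -expr2 -real_normK ?num_real //
    a1 expr1n.
  have sz : `|x ^+ p - z| <= d by rewrite xp close ?a1.
  have [x0 _ _ _ x1] := outer_region zZ sz.
  apply: deriv_sign => //.
  have [t ht ct] := h_near (mem0Z zZ) sz.
  have e1 : `|Num.sg (b z) * a * h x| <= C.
    rewrite normrM -[leRHS]mul1r ler_pM ?(ad_bound0 ad) //.
    by rewrite normrM a1 mulr1.
  rewrite ht xp.
  have -> (y : R) : Num.sg (b z) * a * (n * (t * (z + a * d - z)) - y)
     = a * a * (n * (Num.sg (b z) * t) * d) - Num.sg (b z) * a * y by ring.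
  have /ler_normlP[_ {}e1] := e1.
  rewrite aa mul1r subr_gt0; apply: le_lt_trans e1 _; apply: (lt_le_trans L).
  by rewrite ler_pM2r // ler_wpM2l // ler0n.
have [u up] := @odd_root _ p (z - d) op; have [v vp] := @odd_root _ p (z + d)
  op.
have := sgn 1 v; rewrite normr1 mulr1 mul1r => /(_ erefl vp) A.
have := sgn (-1) u; rewrite normrN normr1 mulrN1 mulN1r => /(_ erefl up) B.
have [||||w /andP[w1 w2] rw] :=
  @ivt_signed _ (Num.sg z * Num.sg (b z)) g^`() u v.
- by rewrite -(ler_odd_exp op) up vp; lra.
- by rewrite mulrN mulNr oppr_gt0 in B; exact: ltW.
- exact: ltW.
- by apply: contraTneq A => ->; rewrite mul0r ltxx.
exists w => //; move: w1 w2; rewrite -(ler_odd_exp op) up => w1.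
by rewrite -(ler_odd_exp op) vp ler_norml; lra.
Qed.

Let mem00 : 0 \in 0 :: crit. Proof. exact: mem_head. Qed.

(** Since [p h(s) = h(x) >= c], the power [s] has the sign of [h'(0)] and is not
    smaller than [c / (p C)]; then [p^2 s h'(s)] is at least of order [p] and
    dominates, as [h'(s)] has the sign of [s] as well. *)
Let origin_crossing (x : R) : `|x ^+ p| <= d -> rho <= `|x| -> `|x| <= 1 ->
  root g^`() x -> 0 < Num.sg (b 0) * x ^+ p /\ 0 < 1 * g^`()^`().[x].
Proof.
have [[[D0 D1] E0] N1] := (d0, c0, C0, n1); move=> sd xr x1 rx.
have sd0 : `|x ^+ p - 0| <= d by rewrite subr0.
have s1 : `|x ^+ p| <= 1 by have := d_half; lra.
have bs := ad_sign ad mem00 sd0; have [t ht ct] := h_near mem00 sd0.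
have nh : c <= n * h (x ^+ p) by rewrite root_eq // (ad_outer ad).
have ee : Num.sg (b 0) * Num.sg (b 0) = 1.
  by rewrite -expr2 sqr_sg (xlogder'_neq0 fm).
set e := Num.sg (b 0) in bs ct ee *.
have es : 0 < e * x ^+ p.
  have : 0 < n * h (x ^+ p) by apply: lt_le_trans nh.
  rewrite (pmulr_rgt0 _ (lt_le_trans ltr01 N1)) ht subr0 -[t * _]mul1r -ee
    mulrACA.
  by rewrite (pmulr_rgt0 _ (lt_le_trans D1 ct)).
split => //.
have s_abs : `|x ^+ p| = e * x ^+ p.
  rewrite -[RHS]gtr0_norm // normrM; have : `|e| = 1; last by move->;
    rewrite mul1r.
  by rewrite /e normr_sg (xlogder'_neq0 fm).
apply: crossing_sign => //.
  by apply: contraTneq es => ->; rewrite expr0n eqn0Ngt (ltnW p_gt1) mulr0 ltxx.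
have cs : c <= C * (n * (e * x ^+ p)).
  apply: (le_trans nh); rewrite [C * _]mulrCA ler_wpM2l ?ler0n //.
  by rewrite -s_abs; apply: le_trans (ler_norm _) (h_lip s1).
have := ler_pM (ltW D1) (ltW D1) cs bs; rewrite -(ler_pM2l (lt_le_trans ltr01
  N1)).
have -> : n * (C * (n * (e * x ^+ p)) * (e * b (x ^+ p)))
  = C * (e * e * (n ^+ 2 * x ^+ p * b (x ^+ p))) by ring.
rewrite ee !mul1r -expr2 => big.
have : C * C < C * (n ^+ 2 * x ^+ p * b (x ^+ p)).
  by rewrite -expr2; apply: lt_le_trans big; exact: ncc.
rewrite ltr_pM2l // subr_gt0; apply: le_lt_trans.
apply: (le_trans (ler_norm _)); rewrite normrM -[leRHS]mul1r ler_pM //.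
exact: (ad_bound1 ad).
Qed.

(** On the side given by the sign of [h'(0)], [p h(x^p) - h(x)] is negative at
    [|x| = rho], where [x^p] is tiny, and positive where [|x^p| = d]. *)
Let origin_root : exists x,
  [/\ rho <= `|x|, `|x| <= 1, `|x ^+ p| <= d & root g^`() x].
Proof.
have [[[D0 D1] E0] N1] := (d0, c0, C0, n1).
have [[[H1 H2] H3] H4] := (d_half, rd, nrC, nc_gt).
have ee : Num.sg (b 0) * Num.sg (b 0) = 1.
  by rewrite -expr2 sqr_sg (xlogder'_neq0 fm).
have e1 : `|Num.sg (b 0)| = 1 by rewrite normr_sg (xlogder'_neq0 fm).
have [v vp] := @odd_root _ p (Num.sg (b 0) * d) op.
have A : 0 < Num.sg (b 0) * 1 * g^`().[v].
  apply: deriv_sign.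
    by rewrite pow_sg ?(xlogder'_neq0 fm) // vp mulrA ee mul1r.
  have vd : `|v ^+ p| <= d by rewrite vp normrM e1 mul1r gtr0_norm.
  have v1 : `|v| <= 1 by apply: pow_unit_inv; lra.
  have vd0 : `|v ^+ p - 0| <= d by rewrite subr0.
  have [t -> ct] := h_near mem00 vd0.
  rewrite subr0 vp mul1r subr_gt0.
  have -> : n * (t * (Num.sg (b 0) * d)) = n * (Num.sg (b 0) * t) * d by ring.
  apply: (le_lt_trans (ler_norm _)); apply: (le_lt_trans (ad_bound0 ad v1)).
  by apply: (lt_le_trans H4); rewrite ler_pM2r // ler_wpM2l // ler0n.
pose u := Num.sg (b 0) * rho.
have u_abs : `|u| = rho by rewrite normrM e1 mul1r gtr0_norm //; lra.
have B : 0 < Num.sg (b 0) * (-1) * g^`().[u].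
  apply: deriv_sign; first by rewrite /u mulrA ee mul1r; lra.
  have hu : c <= h u by apply: (ad_outer ad); rewrite u_abs.
  have := @small_h 1 u; rewrite normr1 u_abs !lexx mul1r => /(_ isT isT).
  have dc : d * c <= c by rewrite ler_piMl //; lra.
  move=> /(le_trans (ler_norm _)); lra.
have us : `|u ^+ p| <= d.
  have := @pow_small u; rewrite u_abs lexx => /(_ isT).
  have : r * rho <= r by rewrite ler_piMr ?(ltW r0) //; lra.
  lra.
have [w [rw wlo whi]] : exists w, [/\ root g^`() w, rho <= `|w| & `|w ^+ p| <=
  d].
  have := xlogder'_neq0 fm mem00; rewrite /u in B us.
  rewrite neq_lt => /orP[] b0; rewrite ?(ltr0_sg b0) ?(gtr0_sg b0) in A B us vp.
    rewrite !mulN1r in A B us vp; rewrite oppr_gt0 in A;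
      rewrite opprK mul1r in B.
    move: us; rewrite ler_norml => /andP[us _].
    have vu : v <= - rho by rewrite -(ler_odd_exp op) vp.
    have [|||w /andP[w1 w2] rw] := @ivt_signed _ 1 g^`() _ _ vu.
    - by rewrite mul1r ltW.
    - by rewrite mul1r ltW.
    - exact: oner_neq0.
    exists w; split => //; first by rewrite ler0_norm; lra.
    rewrite ler0_norm ?exprn_odd_le0 //; last by lra.
    by rewrite lerNl -vp ler_odd_exp.
  rewrite !mul1r in A B us vp; rewrite mulN1r oppr_gt0 in B.
  move: us; rewrite ler_norml => /andP[_ us].
  have uv : rho <= v by rewrite -(ler_odd_exp op) vp.
  have [|||w /andP[w1 w2] rw] := @ivt_signed _ 1 g^`() _ _ uv.
  - by rewrite mul1r ltW.
  - by rewrite mul1r ltW.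
  - exact: oner_neq0.
  exists w; split => //; first by rewrite ger0_norm; lra.
  rewrite ger0_norm ?exprn_odd_ge0 //; last by lra.
  by rewrite -vp ler_odd_exp.
by exists w; split => //; apply: pow_unit_inv; lra.
Qed.

Let near_zero (x : R) : `|x| <= 1 -> `|h x| < c ->
  exists2 z, z \in 0 :: crit & `|x - z| <= d.
Proof.
move=> x1; have [/hasP[z zZ xz] _|/hasPn far] :=
  boolP (has (fun z => `|x - z| < d) (0 :: crit)).
  by exists z => //; exact: ltW.
rewrite ltNge (ad_away ad) // => z zZ.
by rewrite leNgt; apply: far.
Qed.

Let deriv_g0 : ~~ root g^`() 0.
Proof.
apply/negP => /rootP r0'; have := deriv_gf gf 0; rewrite r0' mul0r add0r.
have p1 : (0 < p.-1)%N by rewrite -ltnS prednK // ltnW.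
rewrite expr0n eqn0Ngt p1 mulr0 mul0r.
by apply/eqP; rewrite mulf_neq0 ?(sc_deriv0 fm) // lt0r_neq0 // (g_gt0 f_gt0
  gf).
Qed.

(** By [p h(s) = h(x)] one of the two values is small: [h(x)] when [x^p] is
    tiny, and [h(s)] otherwise, because [h] is bounded. *)
Let located (x : R) : root g^`() x ->
  (exists2 z, z \in crit & `|x - z| <= d) \/
  (exists2 z, z \in 0 :: crit & [/\ rho <= `|x|, `|x| <= 1 & `|x ^+ p - z| <=
    d]).
Proof.
have [[[D0 D1] E0] N1] := (d0, c0, C0, n1).
have N0 : 0 < n by apply: lt_le_trans N1.
have [[[H1 H2] H3] H4] := (d_half, rd, nrC, nc_gt1).
move=> rx; have rt := root_eq rx.
have x1 : `|x| < 1.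
  rewrite ltNge; apply/negP => x1; have s1 : 1 <= `|x ^+ p|.
    by rewrite normrX exprn_ege1.
  have hs : c <= h (x ^+ p) by apply: (ad_outer ad); lra.
  have := ad_bound ad x1; rewrite -rt leNgt; apply/negP/negPn.
  by apply: (lt_le_trans H4); rewrite ler_pM2l.
have [xr|xr] := lerP `|x| rho; last first.
  right; have [|z zZ sz] := near_zero (pow_unit (ltW x1)); last first.
    by exists z => //; split => //; exact: ltW.
  rewrite -(ltr_pM2l N0) -[X in X * `|_|]gtr0_norm // -normrM rt.
  exact: le_lt_trans (ad_bound0 ad (ltW x1)) H4.
(* The bound keeps the factor [|x|]: near the origin [|h(x)| >= c |x|], so that
   this same estimate excludes roots of [g'] there. *)
left; have hx : `|h x| <= n * r * C * `|x|.
  rewrite -rt normrM gtr0_norm // -!mulrA ler_pM2l // mulrCA [r * _]mulrC.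
  apply: (le_trans (h_lip (pow_unit (ltW x1)))).
  by rewrite ler_pM2l // [leRHS]mulrC pow_small.
have x0 : 0 < `|x| by rewrite normr_gt0; apply: contraTneq rx => ->.
have dc : d * c < c by rewrite gtr_pMl //; lra.
have nrCc : n * r * C < c by lra.
have [|z] := near_zero (ltW x1).
  apply: (le_lt_trans hx); apply: le_lt_trans nrCc.
  by rewrite ler_piMr ?(ltW x1) // !mulr_ge0 ?(ltW N0) ?(ltW r0) ?(ltW E0).
rewrite inE => /predU1P[->|zZ xz]; last by exists z.
move=> /(h_near mem00)[t ht ct]; exfalso; move: hx.
rewrite ht subr0 normrM ler_pM2r // leNgt => /negP; apply.
apply: (lt_le_trans nrCc); apply: (le_trans ct); apply: (le_trans (ler_norm _)).
by rewrite normrM ler_piMl.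
Qed.

Let same_center (y z z' : R) : z \in 0 :: crit -> z' \in 0 :: crit ->
  `|y - z| <= d -> `|y - z'| <= d -> z = z'.
Proof.
move=> zZ z'Z yz yz'; apply/eqP; apply/negPn/negP => zz'.
have := ad_sep ad (z := z) (z' := z'); rewrite 2!inE zZ !orbT 2!inE z'Z !orbT
  zz'.
move=> /(_ isT isT isT); apply/negP; rewrite -leNgt.
have -> : z - z' = (y - z') - (y - z) by ring.
by apply: (le_trans (ler_normB _ _)); rewrite mulr2n mulrDl mul1r lerD.
Qed.

Local Notation J :=
  ([seq (false, z) | z <- crit] ++ [seq (true, z) | z <- 0 :: crit]).

(** Index [(false, z)]: the root of [g'] next to [z]. Index [(true, z)]: the
    root of [g'] near the unit circle whose [p]-th power is next to [z]. *)
Let region (j : bool * R) (x : R) : Prop :=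
  if j.1 then [/\ rho <= `|x|, `|x| <= 1 & `|x ^+ p - j.2| <= d]
  else `|x - j.2| <= d.

Let inJ (j : bool * R) : j \in J -> (if j.1 then j.2 \in 0 :: crit else j.2 \in
  crit).
Proof. by rewrite mem_cat => /orP[] /mapP[z zZ ->]. Qed.

Let region_root j : j \in J -> exists2 x, region j x & root g^`() x.
Proof.
move=> /inJ; case: j => [[] z] /=; last exact: inner_root.
rewrite inE => /predU1P[->|zZ].
  have [x [x1 x2 x3 x4]] := origin_root.
  by exists x => //; split; rewrite /= ?subr0.
have [x sz rx] := outer_root zZ; exists x => //.
by have [_ _ _ x1 x2] := outer_region zZ sz.
Qed.

Let region_crossing j x : j \in J -> region j x -> root g^`() x ->
  0 < (if j.1 then if j.2 == 0 then 1 else Num.sg j.2 * Num.sg (b j.2)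
       else - (Num.sg j.2 * Num.sg (b j.2))) * g^`()^`().[x].
Proof.
move=> /inJ; case: j => [[] z] /=; last by move=> zZ; exact: inner_crossing.
rewrite inE => /predU1P[->|zZ [_ _ /= sz] rx].
  by case=> x1 x2 /=; rewrite subr0 eqxx => s rx;
    have [] := origin_crossing s x1 x2 rx.
rewrite ifF; first exact: outer_crossing.
by apply/eqP => z0; have := Z_far0 zZ; rewrite z0 normr0; have := d0; lra.
Qed.

(** The outer region of the origin has a part on each side of it; only one of
    them contains roots, which is why convexity is claimed between two roots. *)
Let region_convex j x y w : j \in J -> region j x -> region j y ->
  root g^`() x -> root g^`() y -> x <= w <= y -> region j w.
Proof.
move=> /inJ; case: j => [[] z] /= zZ; rewrite /region /=; last first.
  by move=> + + _ _ /andP[]; rewrite !ler_norml; lra.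
move=> [x1 x2 x3] [y1 y2 y3] rx ry /andP[xw wy].
have D0 := d0; have D1 := d_half.
have xwp : x ^+ p <= w ^+ p by rewrite ler_odd_exp.
have wyp : w ^+ p <= y ^+ p by rewrite ler_odd_exp.
have sw : `|w ^+ p - z| <= d by move: x3 y3; rewrite !ler_norml; lra.
have w1 : `|w| <= 1 by move: x2 y2; rewrite !ler_norml; lra.
split => //.
have [a xa ya] : exists2 a, 0 < a * x & 0 < a * y.
  move: zZ; rewrite inE => /predU1P[z0|zZ].
    rewrite z0 !subr0 in x3 y3.
    have [sx _] := origin_crossing x3 x1 x2 rx.
    have [sy _] := origin_crossing y3 y1 y2 ry.
    exists (Num.sg (b 0)); by rewrite pow_sg // (xlogder'_neq0 fm).
  have [sx _ _ _ _] := outer_region zZ x3.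
  have [sy _ _ _ _] := outer_region zZ y3.
  by exists (Num.sg z).
have [x0|x0|x0] := ltrgt0P x; last by rewrite x0 mulr0 ltxx in xa.
  apply: (le_trans x1); rewrite !gtr0_norm //; exact: lt_le_trans xw.
have y0 : y < 0.
  rewrite ltNge; apply/negP => y0.
  have a0 : a < 0 by rewrite -(nmulr_lgt0 _ x0).
  by move: ya; rewrite ltNge nmulr_rle0 // y0.
apply: (le_trans y1); rewrite !ltr0_norm ?lerN2 //; exact: le_lt_trans y0.
Qed.

Let region_unique j x y : j \in J -> region j x -> region j y ->
  root g^`() x -> root g^`() y -> x = y.
Proof.
wlog xy : x y / x <= y => [H|] jJ Ix Iy rx ry.
  have [xy|/ltW yx] := lerP x y; first exact: H.
  by apply/esym; exact: H.
apply: (unique_crossing_signed _ xy rx ry) => w xwy rw.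
by apply: (region_crossing jJ) => //; apply: (region_convex jJ Ix Iy).
Qed.

Let region_disjoint i j x : i \in J -> j \in J -> region i x -> region j x -> i
  = j.
Proof.
move=> /inJ + /inJ; case: i j => [[] z] [[] z'] /= zZ z'Z; rewrite /region /=.
- by move=> [_ _ xz] [_ _ xz']; rewrite (same_center zZ z'Z xz xz').
- by move=> [+ _ _] /(near_inner z'Z); rewrite ltNge => ->.
- by move=> /(near_inner zZ) + [+ _ _]; rewrite ltNge => /negP.
- by move=> xz xz'; rewrite (same_center (mem0Z zZ) (mem0Z z'Z) xz xz').
Qed.

Let region_cover x : root g^`() x -> exists2 j, j \in J & region j x.
Proof.
move=> /located[] [z zZ xz].
  by exists (false, z) => //; rewrite mem_cat map_f.
by exists (true, z) => //; rewrite mem_cat map_f ?orbT.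
Qed.

Lemma simple_critical_subst : simple_critical g (2 * m + 1).
Proof.
have [[[D0 D1] E0] N1] := (d0, c0, C0, n1).
have N0 : 0 < n by apply: lt_le_trans N1.
split.
- exact: (g_gt0 f_gt0 gf).
- by apply: contra deriv_g0 => /eqP g0; apply/rootP.
- exists (n * c - C), (n * C); split; first by rewrite subr_gt0 nc_gt1.
  move=> x x1; have s1 : 1 <= `|x ^+ p| by rewrite normrX exprn_ege1.
  have -> : xlogder g x = n * h (x ^+ p) - h x.
    have gx := g_gt0 f_gt0 gf x.
    by rewrite /xlogder (xderiv_g f_gt0 p_gt1 gf) mulrAC divff ?mul1r
      ?lt0r_neq0.
  have hx : c <= h x by apply: (ad_outer ad); lra.
  have hs : c <= h (x ^+ p) by apply: (ad_outer ad); lra.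
  have hx' := ad_bound ad x1; have hs' := ad_bound ad s1.
  have := hs; rewrite -(ler_pM2l N0) => {}hs.
  have := hs'; rewrite -(ler_pM2l N0) => {}hs'.
  lra.
- move=> x rx; have [j jJ jx] := region_cover rx.
  have := region_crossing jJ jx rx; apply: contraTneq => ->.
  by rewrite mulr0 ltxx.
rewrite (@size_rootsR_bij _ _ J _ region) //.
- rewrite size_cat !size_map -[size (0 :: _)]/(size crit).+1 (sc_size fm).
  by rewrite addnS addnn mul2n addn1.
- by apply: contraNneq deriv_g0 => ->; rewrite root0.
- rewrite cat_uniq !map_inj_uniq; try by move=> ? ? [].
  rewrite cons_uniq uniq_roots andTb andbT; apply/andP; split.
    by apply/hasPn => _ /mapP[z _ ->]; apply/negP => /mapP[].
  by apply/negP => /Z_far0; rewrite normr0; lra.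
Qed.


End Step.

Lemma simple_critical_large_prime (R : realType) (f : {poly R}) (m : nat) :
  simple_critical f m -> exists P, forall (p : nat) (g : {poly R}),
    odd p -> (1 < p)%N -> (P <= p)%N -> g * f = f \Po 'X^p ->
  simple_critical g (2 * m + 1).
Proof.
move=> fm; have [d [c [C ad]]] := adapted_exists fm.
have d0 := ad_d0 ad; have c0 := ad_c0 ad; have d_half := adapted_half ad.
have C0 : 0 < C := lt_le_trans c0 (adapted_le ad).
have dc2 : 0 < d * c ^+ 2 by rewrite mulr_gt0 // exprn_gt0.
have e0 : 0 < d * c / C by rewrite divr_gt0 // mulr_gt0.
have r01 : 0 < 1 - d < 1 by apply/andP; split; lra.
have [P smallP] := sqr_geometric_small r01 e0.
exists (maxn P (Num.truncn (C ^+ 2 / (d * c ^+ 2))).+1) => p g op p1.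
rewrite geq_max => /andP[/smallP small Kp] gf.
apply: (simple_critical_subst fm ad op p1 gf).
  rewrite -mulrA -ltr_pdivrMr //; apply: lt_le_trans (truncnS_gt _) _.
  by rewrite ler_nat.
by rewrite -ltr_pdivlMr.
Qed.

(** * A single prime *)

(** The main tool is [f (X - 1) = X^p - 1], together with its derivatives. As [f' >
    0] on [x >= 0], all critical points are negative, where [(x - 1) f''(x) = p
    (p - 1) x^(p-2)] makes each of them an upward crossing of [f']; and [f'(-1)
    < 0 < f'(0)]. *)
Lemma simple_critical_geometric (R : realType) (p : nat) (f : {poly R}) :
  odd p -> (1 < p)%N -> f * ('X - 1) = 'X^p - 1 -> simple_critical f 1.
Proof.
move=> op p1 fX.
have f_sum : f = \sum_(i < p) 'X^i.
  have X1 : ('X - 1 : {poly R}) != 0 by rewrite -polyC1 polyXsubC_eq0.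
  by apply: (mulIf X1); rewrite fX mulrC -subrX1.
have fE x : f.[x] = \sum_(i < p) x ^+ i.
  by rewrite f_sum horner_sum; apply: eq_bigr => i _; rewrite hornerXn.
have f'E x : f^`().[x] = \sum_(i < p) x ^+ i.-1 *+ i.
  rewrite f_sum raddf_sum horner_sum; apply: eq_bigr => i _ /=.
  by rewrite derivXn hornerMn hornerXn.
have E0 x : f.[x] * (x - 1) = x ^+ p - 1.
  by have := congr1 (horner^~ x) fX; rewrite !hornerE.
have E1 x : f^`().[x] * (x - 1) + f.[x] = p%:R * x ^+ p.-1.
  have := congr1 (fun P => P^`().[x]) fX.
  rewrite derivM !derivB derivX derivXn derivC !subr0.
  by rewrite !(hornerD, hornerM, hornerN, hornerMn, hornerXn, hornerX, hornerC)
    mulr1 mulr_natl.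
have E2 x : f^`()^`().[x] * (x - 1) + 2 * f^`().[x] = p%:R * p.-1%:R * x ^+
  p.-2.
  have E := congr1 (fun P => P^`()^`().[x]) fX.
  rewrite derivM !derivB derivX derivXn derivC !subr0 mulr1 derivD derivM in E.
  rewrite derivB derivX derivC subr0 mulr1 derivMn derivXn in E.
  rewrite !(hornerD, hornerM, hornerN, hornerMn, hornerXn, hornerX, hornerC) in
    E.
  rewrite -[_ *+ p]mulr_natl -[_ *+ p.-1]mulr_natl mulrA in E.
  rewrite deriv0 horner0 subr0 in E.
  by rewrite -E; ring.
have f_gt0 x : 0 < f.[x].
  have E := E0 x; have [x1|x1|x1] := ltrgtP x 1.
  - have : x ^+ p < 1 by rewrite -(expr1n _ p) ltr_odd_exp.
    rewrite -subr_lt0 -E nmulr_llt0 ?subr_lt0 //.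
  - have : 1 < x ^+ p by rewrite -(expr1n _ p) ltr_odd_exp.
    by rewrite -subr_gt0 -E pmulr_lgt0 ?subr_gt0.
  - have := E1 x; rewrite x1 subrr mulr0 add0r expr1n mulr1 => ->.
    by rewrite ltr0n ltnW.
have f0 : f.[0] = 1.
  have := E0 0; rewrite expr0n eqn0Ngt (ltnW p1) /=; lra.
have odd_p' : ~~ odd p.-1 by move: op; rewrite -{1}[p]prednK ?(ltnW p1).
have pp : (0 < p.-1)%N by rewrite -ltnS prednK // ltnW.
have f'0 : f^`().[0] = 1.
  by have := E1 0; rewrite f0 expr0n eqn0Ngt pp /=; lra.
have f'_ge0 x : 0 <= x -> 0 < f^`().[x].
  move=> x0; rewrite f'E (bigD1 (Ordinal p1)) //= expr0 mulr1n.
  by rewrite ltr_pwDl // sumr_ge0 // => i _; rewrite mulrn_wge0 // exprn_ge0.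
have root_lt0 x : root f^`() x -> x < 0.
  move=> /rootP rx; rewrite ltNge; apply/negP => /f'_ge0.
  by rewrite rx ltxx.
have root_up x : root f^`() x -> 0 < f^`()^`().[x].
  move=> rx; have x0 := root_lt0 x rx; have := E2 x;
    rewrite (rootP rx) mulr0 addr0.
  have op2 : odd p.-2 by move: odd_p'; rewrite -(prednK pp) /= negbK.
  have xn : p%:R * p.-1%:R * x ^+ p.-2 < 0.
    rewrite pmulr_rlt0 ?exprn_odd_lt0 //.
    by rewrite mulr_gt0 // ltr0n // ltnW.
  move=> E; move: xn; rewrite -E nmulr_llt0 //; lra.
split => //.
- by rewrite f'0 oner_neq0.
- exists (1 / 2), p%:R; split; first lra; move=> x x1.
  have fx := f_gt0 x.
  rewrite /xlogder ler_pdivlMr // ler_pdivrMr //.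
  (* For [x >= 1], [f - 1 <= x f' <= p f] termwise and [f >= p >= 2]. For [x <=
     -1], multiply by [(x - 1)] to reduce to [x^p <= x <= -1]. *)
  have [x0|x0] := lerP 0 x.
    rewrite ger0_norm // in x1.
    have up : x * f^`().[x] <= p%:R * f.[x].
      rewrite fE f'E !mulr_sumr; apply: ler_sum => i _.
      rewrite mulrnAr -mulr_natl.
      case: i => -[|i] ip /=; first by rewrite mul0r mulr_ge0 ?ler0n ?exprn_ge0.
      by rewrite -exprS ler_pM2r ?ler_nat ?(ltnW ip) // exprn_gt0 //
        (lt_le_trans ltr01).
    have f_p : p%:R <= f.[x].
      rewrite fE -[X in X%:R]card_ord -sumr_const; apply: ler_sum => i _.
      exact: exprn_ege1.
    have lo : f.[x] - 1 <= x * f^`().[x].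
      rewrite fE f'E (bigD1 (Ordinal (ltnW p1))) //= expr0 [leLHS]addrC addKr
        mulr_sumr.
      rewrite [leRHS](bigD1 (Ordinal (ltnW p1))) //= mulr0n mulr0 add0r.
      apply: ler_sum => -[[|i] ip] // _; rewrite /= mulrnAr -exprS.
      by rewrite mulrS lerDl mulrn_wge0 // exprn_ge0.
    have p2 : 2 <= p%:R :> R by rewrite ler_nat.
    by apply/andP; split => //; lra.
  have xm1 : x <= -1 by rewrite ltr0_norm // in x1; lra.
  have x_lt : x - 1 < 0 by lra.
  have p2 : 2 <= p%:R :> R by rewrite ler_nat.
  have E0x := E0 x; have E1x := E1 x.
  have t1 : 1 <= x ^+ p.-1.
    by rewrite -[leRHS]ger0_norm ?exprn_even_ge0 // normrX exprn_ege1.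
  have s_eq : x ^+ p = x * x ^+ p.-1 by rewrite -exprS prednK // ltnW.
  have sx : x ^+ p <= x by rewrite s_eq; nra.
  move: (x ^+ p) (x ^+ p.-1) s_eq sx E0x E1x => s t s_eq sx E0x E1x.
  have key : x * f^`().[x] * (x - 1) = p%:R * s - x * f.[x].
    rewrite s_eq; transitivity (x * (f^`().[x] * (x - 1) + f.[x]) - x * f.[x]);
      first ring.
    by rewrite E1x; ring.
  apply/andP; split; rewrite -(ler_nM2r x_lt) key.
    rewrite -(ler_nM2r x_lt).
    have -> : 1 / 2 * f.[x] * (x - 1) = (s - 1) / 2 by rewrite -mulrA E0x; lra.
    have -> : (p%:R * s - x * f.[x]) * (x - 1) = p%:R * (s * (x - 1)) - x * (s
      - 1).
      by rewrite -E0x; ring.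
    have sx0 : 0 <= s * (x - 1) by nra.
    have : 2 * (s * (x - 1)) <= p%:R * (s * (x - 1)) by rewrite ler_wpM2r.
    nra.
  rewrite -mulrA E0x; have : x * f.[x] <= 0 by rewrite nmulr_rle0 // ltW //
    (lt_trans _ fx).
  lra.
- by move=> x /root_up; apply: lt0r_neq0.
rewrite (@size_rootsR_bij _ _ [:: tt] _ (fun _ _ => True)) //.
- by apply: contra_eqN f'0 => /eqP->; rewrite horner0 eq_sym oner_neq0.
- move=> j _; have f'1 : f^`().[-1] < 0.
    have := E1 (-1); have := E0 (-1).
    rewrite -signr_odd op -[(-1) ^+ p.-1]signr_odd (negbTE odd_p').
    have p2 : 2 <= p%:R :> R by rewrite ler_nat.
    rewrite expr1 expr0 mulr1; lra.
  have [||||w _ rw] := @ivt_signed _ 1 f^`() (-1) 0.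
  + by rewrite lerN10.
  + by rewrite mul1r ltW.
  + by rewrite mul1r f'0.
  + exact: oner_neq0.
  by exists w.
- have uniq_le x y : x <= y -> root f^`() x -> root f^`() y -> x = y.
    move=> xy rx ry; apply: (unique_crossing _ xy rx ry) => w _; exact: root_up.
  move=> j x y _ _ _ rx ry; have [xy|/ltW yx] := lerP x y.
    exact: uniq_le.
  by apply/esym/uniq_le.
- by move=> [] [].
- by move=> x _; exists tt.
Qed.

(** * Separated primes *)

Lemma simple_critical_Phi_prime (R : realType) (p : nat) :
  odd_prime p -> simple_critical (real_Phi R p) 1.
Proof.
move=> /andP[pp op]; apply: (simple_critical_geometric op (prime_gt1 pp)).
have p_ndvd1 : ~~ (p %| 1)%N by rewrite dvdn1 neq_ltn prime_gt1 ?orbT.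
rewrite -real_Phi1 -[X in real_Phi R X * _]mul1n real_Phi_mul_prime //.
by rewrite real_Phi1 comp_polyB comp_polyX comp_polyC.
Qed.

Lemma cyclotomic_deriv_condP (R : realType) (ps : seq nat) :
  simple_critical (real_Phi R (\prod_(p <- ps) p)%N) (2 ^ size ps - 1) ->
  cyclotomic_deriv_cond R ps.
Proof.
move=> fm; have simple x :
    root (real_Phi R (\prod_(p <- ps) p)%N)^`() x ->
    mup x (real_Phi R (\prod_(p <- ps) p)%N)^`() = 1%N.
  by move=> rx; exact: mup_simple rx (sc_simple fm rx).
split=> //; rewrite /nb_real_roots -(sc_size fm) -sum1_size.
by apply: eq_big_seq => x; rewrite (mem_critical fm) => /simple.
Qed.

Lemma separated_quant_simple_critical (R : realType) (k : nat) (ps : seq nat) :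
  (0 < \prod_(p <- ps) p)%N ->
  simple_critical (real_Phi R (\prod_(p <- ps) p)%N) (2 ^ size ps - 1) ->
  separated_quant (cyclotomic_deriv_cond R) k ps.
Proof.
elim: k ps => [|k IH] ps N0 fm /=; first exact: cyclotomic_deriv_condP.
have [P step] := simple_critical_large_prime fm.
set N := (\prod_(p <- ps) p)%N in N0 fm step *.
(* A prime larger than the product [N] divides none of the previous primes. *)
exists (maxn (last 0 ps).+1 (maxn P N.+1))%N; split;
  first by rewrite leq_max leqnn.
move=> p /andP[pp op]; rewrite !geq_max => /and3P[_ Pp Np].
have prodE : (\prod_(q <- rcons ps p) q = N * p)%N by rewrite -cats1 big_cat
  big_seq1.
apply: IH; rewrite prodE ?muln_gt0 ?N0 ?prime_gt0 //.
have -> : (2 ^ size (rcons ps p) - 1 = 2 * (2 ^ size ps - 1) + 1)%N.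
  by rewrite size_rcons expnS; have := expn_gt0 2 (size ps); lia.
apply: step op (prime_gt1 pp) Pp _; apply: real_Phi_mul_prime => //.
by apply/negP => /(dvdn_leq N0); rewrite leqNgt Np.
Qed.

Theorem theorem1 (R : realType) (k : nat) (hk : (1 <= k)%N)
    (p1 : nat) (hp1 : odd_prime p1) :
  separated_quant (cyclotomic_deriv_cond R) (k - 1) [:: p1].
Proof.
have /andP[p1_prime _] := hp1.
apply: separated_quant_simple_critical; rewrite big_seq1 ?prime_gt0 //.
exact: simple_critical_Phi_prime.
Qed.
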